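(* Let $\prec$ be a compatible weak preference on a real vector space $Y$, with positive cone $P_\prec$ and set of open components $\mathcal{O}(P_\prec)$. Then the family $\mathcal{T}(\prec):=\{\prec_E\mid E\in\mathcal{O}(P_\prec)\}$ is linearly ordered by $\unlhd'$, and each $\prec_E\,\in\mathcal{T}(\prec)$ is a relatively open compatible partial preference on $Y$ whose restriction to the vector subspace $\mathrm{Lin}(E)$ is a weak preference.
   Context: A partial preference on a real vector space $Y$ is an asymmetric and transitive binary relation $\prec$. Its indifference relation $\asymp$ is: $y\asymp z$ iff neither $y\prec z$ nor $z\prec y$. A partial preference is a weak preference if $\asymp$ is transitive (the same definition is used for relations on a subspace). A partial preference is compatible if $y_1\prec y_2$ implies $\lambda y_1\prec\lambda y_2$ and $y_1+y\prec y_2+y$ for all $y\in Y$ and all real $\lambda>0$. Its positive cone is $P_\prec=\{y\in Y\mid 0\prec y\}$; then $y_1\prec y_2\iff y_2-y_1\in P_\prec$. Majorization: for $y,z\in P_\prec$ write $y\unlhd z$ if there is a real $\mu>0$ with $\mu y\prec z$. This is a preorder on $P_\prec$; write $y\approx z$ if $y\unlhd z$ and $z\unlhd y$. The equivalence classes $\mathcal{O}(P_\prec)=P_\prec/\!\approx$ are called the open components of $P_\prec$. They are partially ordered by $\unlhd^*$: $E_1\unlhd^*E_2$ iff $y_1\unlhd y_2$ for all (equivalently, some) $y_1\in E_1$, $y_2\in E_2$. For $E\in\mathcal{O}(P_\prec)$ the relation $\prec_E$ on $Y$ is defined by $y_1\prec_E y_2\iff y_2-y_1\in E$. On $\mathcal{T}(\prec)$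 the order $\unlhd'$ is defined by $\prec_{E_1}\unlhd'\prec_{E_2}\iff E_1\unlhd^*E_2$. $\mathrm{Lin}(E)=E-E$ is the linear hull of the convex cone $E$. The relative algebraic interior $\mathrm{icr}\,Q$ of $Q\subset Y$ is the set of $z\in Q$ such that for every $y\in\mathrm{aff}\,Q\setminus\{z\}$ ($\mathrm{aff}$ = affine hull) there is $\delta>0$ with $z+t(y-z)\in Q$ for all $t\in(-\delta,\delta)$. A compatible partial preference is relatively open if its positive cone $P$ satisfies $\mathrm{icr}\,P\neq\varnothing$ and $P=\mathrm{icr}\,P$. *)

(* Defs.v *)
From HB Require Import structures.
From mathcomp Require Import all_boot all_order all_algebra.
From mathcomp Require Import boolp classical_sets reals.
Set Implicit Arguments.
Unset Strict Implicit.
Unset Printing Implicit Defensive.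
Import Order.TTheory GRing.Theory Num.Theory.
Local Open Scope classical_set_scope.
Local Open Scope ring_scope.

(* The order-theoretic notions make no use of the vector space structure, so
   they are given on an arbitrary type; this lets them apply both to [Y] and to
   a subset of [Y] seen as a type through the coercion [set_type]. *)
Section Preferences.
Context {T : Type}.
Implicit Types prec le : T -> T -> Prop.

Definition partial_preference prec : Prop :=
  (forall y z, prec y z -> ~ prec z y) /\
  (forall x y z, prec x y -> prec y z -> prec x z).

Definition indifferent prec (y z : T) : Prop := ~ prec y z /\ ~ prec z y.

Definition weak_preference prec : Prop :=
  partial_preference prec /\
  (forall x y z, indifferent prec x y -> indifferent prec y z ->
    indifferent prec x z).

Definition restriction (A : set T) prec : A -> A -> Prop :=
  fun u v => prec (val u) (val v).

Definition linearly_ordered_by (A : set T) le : Prop :=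
  [/\ forall x, A x -> le x x,
      forall x y, A x -> A y -> le x y -> le y x -> x = y,
      forall x y z, A x -> A y -> A z -> le x y -> le y z -> le x z
    & total_on A le].

End Preferences.

Section VectorPreferences.
Context {R : realType} {Y : lmodType R}.
Implicit Types (prec : Y -> Y -> Prop) (E Q : set Y).

Definition compatible prec : Prop :=
  forall y1 y2, prec y1 y2 ->
    (forall lambda : R, 0 < lambda -> prec (lambda *: y1) (lambda *: y2)) /\
    (forall y, prec (y1 + y) (y2 + y)).

Definition positive_cone prec : set Y := [set y | prec 0 y].

(* Meant for [y] and [z] in the positive cone of [prec]. *)
Definition majorized prec (y z : Y) : Prop :=
  exists2 mu : R, 0 < mu & prec (mu *: y) z.

Definition majorization_equiv prec (y z : Y) : Prop :=
  majorized prec y z /\ majorized prec z y.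

(* The quotient of the positive cone by [majorization_equiv prec], as the set
   of the equivalence classes. *)
Definition open_components prec : set (set Y) :=
  [set E | exists2 y, positive_cone prec y &
     E = [set z | positive_cone prec z /\ majorization_equiv prec y z]].

Definition component_le prec (E1 E2 : set Y) : Prop :=
  forall y1 y2, E1 y1 -> E2 y2 -> majorized prec y1 y2.

Definition cone_rel E : Y -> Y -> Prop := fun y1 y2 => E (y2 - y1).

Definition component_rels prec : set (Y -> Y -> Prop) :=
  [set cone_rel E | E in open_components prec].

(* [E] is determined by [cone_rel E], so the existential quantifiers range over
   at most one pair of components. *)
Definition component_rel_le prec (r1 r2 : Y -> Y -> Prop) : Prop :=
  exists E1 E2, [/\ open_components prec E1, open_components prec E2,
    r1 = cone_rel E1, r2 = cone_rel E2 & component_le prec E1 E2].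

Definition Lin E : set Y :=
  [set z | exists x y, [/\ E x, E y & z = x - y]].

Definition affine_set Q : Prop :=
  forall x y (t : R), Q x -> Q y -> Q (x + t *: (y - x)).

Definition affine_hull Q : set Y := smallest affine_set Q.

Definition icr Q : set Y :=
  [set z | Q z /\ forall y, affine_hull Q y -> y <> z ->
     exists2 delta : R, 0 < delta &
       forall t : R, - delta < t < delta -> Q (z + t *: (y - z))].

Definition relatively_open prec : Prop :=
  icr (positive_cone prec) !=set0 /\
  positive_cone prec = icr (positive_cone prec).

End VectorPreferences.

(* Main.v *)
Require Import Defs.
From mathcomp Require Import all_boot all_order all_algebra.
From mathcomp Require Import boolp classical_sets reals.
From mathcomp Require Import lra.
Set Implicit Arguments.
Unset Strict Implicit.
Unset Printing Implicit Defensive.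
Import Order.TTheory GRing.Theory Num.Theory.
Local Open Scope classical_set_scope.
Local Open Scope ring_scope.

(** A weak preference is negatively transitive: if [x] precedes [z], every [y]
    satisfies [x] before [y] or [y] before [z].  Applied to [y1], [y2], [2 y1],
    this makes majorization total on the positive cone.  A component [E] is
    order-convex for majorization, so [z + t w] stays in [E] for [z] in [E],
    [w] in [Lin E] and small [t]; this is relative openness.  If [u] in [Lin E]
    and [-u] is not in [E], then [z / 4] cannot precede [-u], so negative
    transitivity puts [-u] before [z / 2]; hence [z + u] is in [E], which is
    the negative transitivity of [cone_rel E] on [Lin E]. *)

Lemma weak_preference_split {T : Type} {prec : T -> T -> Prop} :
  weak_preference prec ->
  forall y x z, prec x z -> prec x y \/ prec y z.
Proof.
move=> [[_ tr] itr] y x z xz; apply: contrapT => /not_orP[nxy nyz].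
(* If [y] followed neither from [x] nor into [z], then [y] before [x] would give [y] before [z], and
   [z] before [y] would give [x] before [y]. So [y] would be indifferent to both, against
   [prec x z]. *)
have xy : indifferent prec x y by split=> // yx; exact/nyz/(tr _ _ _ yx xz).
have yz : indifferent prec y z by split=> // zy; exact/nxy/(tr _ _ _ xz zy).
by case: (itr _ _ _ xy yz).
Qed.

Lemma split_weak_preference {T : Type} {prec : T -> T -> Prop} :
  partial_preference prec ->
  (forall x y z, prec x z -> prec x y \/ prec y z) -> weak_preference prec.
Proof.
move=> pp sp; split=> // x y z [nxy nyx] [nyz nzy].
by split=> [/(sp _ y)[]|/(sp _ y)[]].
Qed.

Lemma scale_halfD {R : realType} {Y : lmodType R} (x : Y) :
  2^-1 *: x + 2^-1 *: x = x.
Proof. by rewrite -scalerDl (_ : 2^-1 + 2^-1 = 1) ?scale1r //; lra. Qed.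

(** * Compatible preferences and majorization *)

Section CompatiblePreference.
Context {R : realType} {Y : lmodType R} {prec : Y -> Y -> Prop}.
Context (pp : partial_preference prec) (cp : compatible prec).
Implicit Types (x y z w a b : Y) (E : set Y).

Let tr y x z : prec x y -> prec y z -> prec x z.
Proof. exact: (pp.2 x y z). Qed.

Lemma prec_irr x : ~ prec x x.
Proof. by move=> xx; exact: (pp.1 _ _ xx). Qed.

Lemma precZ {l : R} {x y} : 0 < l -> prec x y -> prec (l *: x) (l *: y).
Proof. by move=> l0 /cp[+ _]; apply. Qed.

Lemma precDr {x y} z : prec x y -> prec (x + z) (y + z).
Proof. by move=> /cp[_]; apply. Qed.

Lemma precD x y z w : prec x y -> prec z w -> prec (x + z) (y + w).
Proof.
move=> xy zw; apply: (@tr (y + z)); first exact: precDr.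
by rewrite ![y + _]addrC; exact: precDr.
Qed.

Lemma prec_sub0 x y : prec 0 (y - x) <-> prec x y.
Proof.
split=> [/(precDr x)|/(precDr (- x))]; first by rewrite add0r subrK.
by rewrite subrr.
Qed.

Lemma prec_addr x y : prec 0 y -> prec x (x + y).
Proof. by move=> y0; rewrite addrC -[X in prec X]add0r; exact: precDr. Qed.

Lemma prec_scale {x} {s t : R} : prec 0 x -> s < t -> prec (s *: x) (t *: x).
Proof.
move=> x0 st; apply/prec_sub0; rewrite -scalerBl -(scaler0 _ (t - s)).
by apply: precZ; rewrite ?subr_gt0.
Qed.

Lemma prec_majorized x y : prec x y -> majorized prec x y.
Proof. by move=> xy; exists 1; rewrite ?scale1r. Qed.

Lemma majorized_refl x : prec 0 x -> majorized prec x x.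
Proof.
(* Irreflexivity rules out the witness 1; any positive scalar below 1 would do. *)
move=> x0; exists 2^-1; first lra.
by rewrite -[X in prec _ X]scale1r; apply: prec_scale => //; lra.
Qed.

Lemma majorized_trans y x z :
  majorized prec x y -> majorized prec y z -> majorized prec x z.
Proof.
move=> [m m0 xy] [n n0 yz]; exists (n * m); first exact: mulr_gt0.
by rewrite -scalerA; apply: tr yz; exact: precZ.
Qed.

Lemma majorizedD x y z :
  majorized prec x z -> majorized prec y z -> majorized prec (x + y) z.
Proof.
move=> [m m0 xz] [n n0 yz]; have mn0 : 0 < m + n by lra.
(* [z] is split with weights [n / (m + n)] and [m / (m + n)], chosen so that [x] and [y] end up with
   the same coefficient [m * n / (m + n)]. *)
exists (n / (m + n) * m); first by rewrite mulr_gt0 ?divr_gt0.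
have -> : z = (n / (m + n)) *: z + (m / (m + n)) *: z.
  by rewrite -scalerDl -mulrDl [n + m]addrC divff ?scale1r ?gt_eqF.
rewrite scalerDr; apply: precD; first by rewrite -scalerA; exact: precZ (divr_gt0 n0 mn0) xz.
by rewrite mulrAC [n * m]mulrC mulrAC -[_ *: y]scalerA; exact: precZ (divr_gt0 m0 mn0) yz.
Qed.

Lemma majorized_scalel {l : R} x y :
  0 < l -> majorized prec x y -> majorized prec (l *: x) y.
Proof.
move=> l0 [m m0 xy]; exists (m / l); first exact: divr_gt0.
by rewrite scalerA divfK // gt_eqF.
Qed.

Lemma majorized_scaler {l : R} x y :
  0 < l -> majorized prec x y -> majorized prec x (l *: y).
Proof.
move=> l0 [m m0 xy]; exists (l * m); first exact: mulr_gt0.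
by rewrite -scalerA; exact: precZ.
Qed.

Lemma majorized_pos x y : prec 0 x -> majorized prec x y -> prec 0 y.
Proof. by move=> x0 [m m0]; apply: tr; rewrite -(scaler0 _ m); exact: precZ. Qed.

(** * Cone structure and openness of a single component *)

Section Component.
Context {E : set Y} (oE : open_components prec E).

Lemma component_neq0 : exists y, E y.
Proof.
case: oE => y y0 ->; exists y; split=> //; split; exact: majorized_refl.
Qed.

Lemma component_pos x : E x -> prec 0 x.
Proof. by case: oE => y _ -> []. Qed.

Lemma component_majorized x y : E x -> E y -> majorized prec x y.
Proof.
by case: oE => e _ -> [_ [_ xe]] [_ [ey _]]; exact: majorized_trans xe ey.
Qed.

(** The main tool for proving membership in [E]: the lower bound [x] also forces [z] into the
    positive cone. *)
Lemma component_convex x y z :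
  E x -> E y -> majorized prec x z -> majorized prec z y -> E z.
Proof.
move=> Ex; have x0 := component_pos Ex; move: Ex.
case: oE => e _ -> [_ [ex _]] [_ [_ ye]] xz zy.
split; [exact: majorized_pos xz|split; [exact: majorized_trans ex xz|]].
exact: majorized_trans zy ye.
Qed.

Lemma componentD x y : E x -> E y -> E (x + y).
Proof.
move=> Ex Ey; apply: (component_convex Ex Ex).
  by apply/prec_majorized/prec_addr/component_pos.
by apply: majorizedD; exact: component_majorized.
Qed.

Lemma componentZ (l : R) x : 0 < l -> E x -> E (l *: x).
Proof.
move=> l0 Ex; have xx := component_majorized Ex Ex.
by apply: (component_convex Ex Ex);
  [exact: majorized_scaler|exact: majorized_scalel].
Qed.

Lemma component_Lin x : E x -> Lin E x.
(* Both terms must lie in [E], which does not contain 0, hence [(x + x) - x]. *)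
Proof. by move=> Ex; exists (x + x), x; rewrite addrK; split=> //; exact: componentD. Qed.

Lemma LinD x y : Lin E x -> Lin E y -> Lin E (x + y).
Proof.
move=> [a [b [Ea Eb ->]]] [c [d [Ec Ed ->]]].
by exists (a + c), (b + d); rewrite opprD addrACA; split=> //; exact: componentD.
Qed.

Lemma LinZ (l : R) x : Lin E x -> Lin E (l *: x).
Proof.
(* [E] is stable under positive scalars only: a negative one swaps the two terms, and zero needs its
   own witness. *)
move=> [a [b [Ea Eb ->]]]; case: (ltgtP l 0) => [l0|l0|->].
- exists ((- l) *: b), ((- l) *: a); split; try by apply: componentZ; rewrite ?oppr_gt0.
  by rewrite scalerBr !scaleNr opprK addrC.
- by exists (l *: a), (l *: b); rewrite scalerBr; split=> //; exact: componentZ.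
- by exists a, a; rewrite scale0r subrr.
Qed.

Lemma LinB x y : Lin E x -> Lin E y -> Lin E (x - y).
Proof. by move=> Lx Ly; rewrite -scaleN1r; apply: LinD => //; exact: LinZ. Qed.

Lemma Lin_submod_closed : GRing.submod_closed [in Lin E].
Proof.
have mE x : (x \in [in Lin E]) = (x \in Lin E) by [].
split=> [|l x y]; rewrite !mE !in_setE; last first.
  by move=> Lx Ly; apply: LinD => //; exact: LinZ.
have [y Ey] := component_neq0.
by rewrite -(subrr y); apply: LinB; exact: component_Lin.
Qed.

(** The upper bound is automatic: writing [w = a - b], the vector [z + w] precedes [z + a], which is
    in [E]. Only the lower bound has to be supplied. *)
Lemma component_translate z w : E z -> Lin E w -> majorized prec z (z + w) ->
  E (z + w).
Proof.
move=> Ez [a [b [Ea Eb ->]]] zw.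
apply: (component_convex Ez (componentD Ez Ea)) => //.
apply: prec_majorized; rewrite addrA -[X in prec _ X](subrK b).
exact/prec_addr/component_pos.
Qed.

Lemma component_open_along z b : E z -> E b ->
  exists2 d : R, 0 < d & forall t, - d < t < d -> E (z + t *: b).
Proof.
move=> Ez Eb; have [n n0 bz] := component_majorized Eb Ez.
(* Since [n *: b] precedes [z], the vector [- t *: b] precedes [z / 2] once [- t < n / 2]; then
   [z / 2] precedes [z + t *: b]. *)
exists (2^-1 * n) => [|t /andP[t0 _]]; first lra.
apply: component_translate => //; first exact/LinZ/component_Lin.
exists 2^-1; first lra.
have : prec (- t *: b) (2^-1 *: z).
  apply: (@tr ((2^-1 * n) *: b)); first by apply: prec_scale; [exact: component_pos|lra].
  by rewrite -scalerA; apply: precZ => //; lra.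
move=> /(precDr (2^-1 *: z + t *: b)).
by rewrite addrCA scaleNr addNr addr0 addrA scale_halfD.
Qed.

Lemma component_open z w : E z -> Lin E w ->
  exists2 d : R, 0 < d & forall t, - d < t < d -> E (z + t *: w).
Proof.
move=> Ez [a [b [Ea Eb ->]]].
(* One half of [z] absorbs [t *: a], the other absorbs [- t *: b]. *)
have E2 : E (2^-1 *: z) by apply: componentZ => //; lra.
have [d d0 da] := component_open_along E2 Ea.
have [e e0 eb] := component_open_along E2 Eb.
exists (Num.min d e) => [|t]; first by rewrite lt_min d0.
rewrite lt_min ltrNl lt_min => /andP[/andP[td te] /andP[dt et]].
have -> : z + t *: (a - b) = (2^-1 *: z + t *: a) + (2^-1 *: z + - t *: b).
  by rewrite addrACA scale_halfD scaleNr scalerBr.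
by apply: componentD; [apply: da|apply: eb]; apply/andP; split; lra.
Qed.

Lemma affine_hull_Lin y : affine_hull E y -> Lin E y.
Proof.
(* The hull is an intersection, so it is enough that [Lin E] is an affine set containing [E]. *)
apply; split=> [a b t La Lb|]; last exact: component_Lin.
by apply: LinD => //; apply/LinZ/LinB.
Qed.

Lemma positive_cone_cone_rel : positive_cone (cone_rel E) = E.
Proof. by apply/funext => y; rewrite /positive_cone /cone_rel /= subr0. Qed.

Lemma icr_component : icr E = E.
Proof.
apply/seteqP; split=> [z []//|z Ez]; split=> // y /affine_hull_Lin Ly _.
by apply: component_open => //; apply: LinB => //; exact: component_Lin.
Qed.

Lemma component_relatively_open : relatively_open (cone_rel E).
Proof.
by rewrite /relatively_open positive_cone_cone_rel icr_component; split=> //;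
  exact: component_neq0.
Qed.

Lemma component_partial : partial_preference (cone_rel E).
Proof.
split=> [y z yz zy|x y z xy yz].
  (* Two opposite differences in [E] would add up to 0 in [E]. *)
  apply: (@prec_irr 0); apply: component_pos.
  by have := componentD yz zy; rewrite subrKA subrr.
by have := componentD yz xy; rewrite subrKA.
Qed.

Lemma component_compatible : compatible (cone_rel E).
Proof.
move=> y1 y2 y12; split=> [l l0|y]; rewrite /cone_rel.
  by rewrite -scalerBr; exact: componentZ.
by rewrite opprD addrACA subrr addr0.
Qed.

(** * Weak preference on the linear hull *)

Lemma component_absorb u z : weak_preference prec ->
  Lin E u -> ~ E (- u) -> E z -> E (z + u).
Proof.
move=> wp Lu nEu Ez; have z0 := component_pos Ez.
apply: component_translate => //; exists 2^-1; first lra.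
have /(weak_preference_split wp (- u))[zu|uz] : prec (4^-1 *: z) (2^-1 *: z).
  by apply: prec_scale => //; lra.
(* Here [- u = b - a] follows [z / 4] and precedes [b], so order-convexity would put it in [E]. *)
- case: nEu; case: Lu zu => a [b [Ea Eb ->]] zu.
  apply: (component_convex Ez Eb); first by exists 4^-1 => //; lra.
  apply: prec_majorized; rewrite opprB -[X in prec _ X](subrK a).
  exact/prec_addr/component_pos.
- have := precDr (2^-1 *: z + u) uz.
  by rewrite addrCA addNr addr0 addrA scale_halfD.
Qed.

Lemma component_weak_Lin : weak_preference prec ->
  weak_preference (restriction (A := Lin E) (cone_rel E)).
Proof.
move=> wp; apply: split_weak_preference.
  by split=> [y z|x y z]; [exact: component_partial.1|exact: component_partial.2].
move=> x y z xz; have [xy|nxy] := pselect (cone_rel E (val x) (val y)); [by left|right].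
have Lin_val (v : Lin E) : Lin E (val v) by rewrite -in_setE; exact: valP.
(* The difference [z - y] is [(z - x) + (x - y)], with [z - x] in [E] and [y - x] outside it. *)
rewrite /restriction /cone_rel -(subrKA (val x)).
by apply: component_absorb => //; [exact: LinB|rewrite opprB].
Qed.

End Component.

(** * Linear ordering of the components *)

Lemma cone_rel_inj : injective (@cone_rel R Y).
Proof.
move=> E F EF; apply/funext => y.
by have := congr1 (fun r => r 0 y) EF; rewrite /cone_rel subr0.
Qed.

(** Each element of one component is squeezed, for majorization, between a fixed element of the
    other and itself. *)
Lemma component_le_anti E F : open_components prec E -> open_components prec F ->
  component_le prec E F -> component_le prec F E -> E = F.
Proof.
move=> oE oF EF FE; have [[e Ee] [f Ff]] := (component_neq0 oE, component_neq0 oF).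
apply/seteqP; split=> x Hx.
  by apply: (component_convex oF Ff Ff); [exact: FE|exact: EF].
by apply: (component_convex oE Ee Ee); [exact: EF|exact: FE].
Qed.

Lemma majorized_component_le E F x y :
  open_components prec E -> open_components prec F ->
  E x -> F y -> majorized prec x y -> component_le prec E F.
Proof.
move=> oE oF Ex Fy xy e f Ee Ff.
apply: (majorized_trans (component_majorized oE Ee Ex)).
exact: majorized_trans xy (component_majorized oF Fy Ff).
Qed.

Lemma component_rels_linear : weak_preference prec ->
  linearly_ordered_by (component_rels prec) (component_rel_le prec).
Proof.
move=> wp; split.
- move=> _ [E oE <-]; exists E, E; split=> // x y.
  exact: component_majorized.
- move=> r s _ _ [E [F [oE oF -> -> EF]]] [F' [E' [_ _ /cone_rel_inj <- /cone_rel_inj <- FE]]].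
  by rewrite (component_le_anti oE oF EF FE).
- move=> r s t _ _ _ [E [F [oE oF -> -> EF]]] [F' [G [_ oG /cone_rel_inj <- -> FG]]].
  exists E, G; split=> // x z Ex Gz; have [y Fy] := component_neq0 oF.
  exact: majorized_trans (EF _ _ Ex Fy) (FG _ _ Fy Gz).
- move=> _ _ [E oE <-] [F oF <-].
  have [[x Ex] [y Fy]] := (component_neq0 oE, component_neq0 oF).
  have x2 : prec (1 *: x) (2 *: x) by apply: prec_scale; [exact: component_pos Ex|lra].
  (* Either [x] precedes [y], with majorization factor 1, or [y] precedes [2 *: x], which halves to
     factor [2^-1]. *)
  have [xy|yx] := weak_preference_split wp y x2; [left; exists E, F|right; exists F, E].
    by split=> //; apply: (majorized_component_le oE oF Ex Fy); exists 1.
  split=> //; apply: (majorized_component_le oF oE Fy Ex).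
  exists 2^-1; first lra.
  have := precZ (_ : 0 < 2^-1) yx; rewrite scalerA mulVf ?scale1r ?pnatr_eq0 //.
  by apply; lra.
Qed.

End CompatiblePreference.

Theorem theorem4p12 (R : realType) (Y : lmodType R) (prec : Y -> Y -> Prop)
    (prec_weak : weak_preference prec) (prec_compat : compatible prec) :
  linearly_ordered_by (component_rels prec) (component_rel_le prec) /\
  (forall E : set Y, open_components prec E ->
    [/\ partial_preference (cone_rel E), compatible (cone_rel E),
        relatively_open (cone_rel E), GRing.submod_closed [in Lin E]
      & weak_preference (restriction (A := Lin E) (cone_rel E))]).
Proof.
have pp := prec_weak.1; split; first exact: component_rels_linear.
move=> E oE; split.
- exact: component_partial oE.
- exact: component_compatible oE.
- exact: component_relatively_open oE.
- exact: Lin_submod_closed oE.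
- exact: component_weak_Lin oE prec_weak.
Qed.
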